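(* Let $E,F$ be Banach lattices with $F$ Dedekind complete, and let $\mathcal{P}$ be a linear subspace of $\mathrm{L}(E,F)$ satisfying the domination property. Then $\text{r-}\mathcal{P}(E,F)$ is an order ideal in the Dedekind complete vector lattice $\mathrm{L}_r(E,F)$.
   Context: Vector spaces are real. $\mathrm{L}(E,F)$ is the space of bounded linear operators from $E$ to $F$; $\mathrm{L}_r(E,F)$ is the space of regular operators (differences of two positive linear operators), ordered by $S\le T$ iff $T-S$ is positive. $\mathcal{P}$ satisfies the domination property if $0\le S\le T\in\mathcal{P}$ implies $S\in\mathcal{P}$. $\text{r-}\mathcal{P}(E,F)$ is the set of operators $T=T_1-T_2$ with $T_1,T_2\in\mathcal{P}$ positive. *)

(* Defs.v *)
From HB Require Import structures.
From mathcomp Require Import all_boot all_order all_algebra.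
From mathcomp Require Import all_classical all_reals all_analysis.

Set Implicit Arguments.
Unset Strict Implicit.
Unset Printing Implicit Defensive.

Import Order.TTheory GRing.Theory Num.Theory.
Import numFieldNormedType.Exports.

Local Open Scope classical_set_scope.
Local Open Scope ring_scope.

Reserved Notation "x <=v y" (at level 70, no associativity).

(* The order is a relation of this structure rather than an Order.POrder:
   Num.NumDomain already joins Order.POrder with a norm, and HB does not accept
   a new common substructure of the two declared after it. *)
HB.mixin Record isOrderedLmodule (R : realType) V of GRing.Lmodule R V := {
  vle : V -> V -> Prop;
  vle_refl : forall x, vle x x;
  vle_anti : forall x y, vle x y -> vle y x -> x = y;
  vle_trans : forall y x z, vle x y -> vle y z -> vle x z;
  vleD2r : forall z x y, vle x y -> vle (x + z) (y + z);
  scalev_ge0 : forall (a : R) x, 0 <= a -> vle 0 x -> vle 0 (a *: x)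
}.

#[short(type="orderedLmodType")]
HB.structure Definition OrderedLmodule (R : realType) :=
  {V of GRing.Lmodule R V & isOrderedLmodule R V}.

Notation "x <=v y" := (vle x y) : ring_scope.

Section OrderedVectorSpaces.
Context {R : realType}.

Definition linear_subspace {V : lmodType R} (A : set V) : Prop :=
  A 0 /\ forall (a : R) (x y : V), A x -> A y -> A (a *: x + y).

Definition upper_bounds {V : orderedLmodType R} (A : set V) : set V :=
  [set u | forall x, A x -> x <=v u].

Definition suprema {V : orderedLmodType R} (A : set V) : set V :=
  [set s | upper_bounds A s /\ forall u, upper_bounds A u -> s <=v u].

(* Binary infima then exist too, by x |-> - x. *)
Definition is_vector_lattice (V : orderedLmodType R) : Prop :=
  forall x y : V, suprema [set x; y] !=set0.

Definition dedekind_complete (V : orderedLmodType R) : Prop :=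
  forall A : set V, A !=set0 -> upper_bounds A !=set0 -> suprema A !=set0.

(* The supremum of x and - x; the default value 0 is never reached in a vector
   lattice. *)
Definition modulus {V : orderedLmodType R} (x : V) : V :=
  xget 0 (suprema [set x; - x]).

Definition order_ideal {V : orderedLmodType R} (I : set V) : Prop :=
  linear_subspace I /\
  forall x y : V, modulus x <=v modulus y -> I y -> I x.

End OrderedVectorSpaces.

HB.mixin Record isBanachLattice (R : realType) V
    of OrderedLmodule R V & CompleteNormedModule R V := {
  blat_vector_lattice : is_vector_lattice V;
  blat_norm_le : forall x y : V, modulus x <=v modulus y -> `|x| <= `|y|
}.

#[short(type="banachLatticeType")]
HB.structure Definition BanachLattice (R : realType) :=
  {V of OrderedLmodule R V & CompleteNormedModule R V & isBanachLattice R V}.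

Section Operators.
Context {R : realType}.
Variables E F : banachLatticeType R.

Definition bounded_op : set (E -> F) :=
  [set T | linear T /\ bounded_fun_norm T].

Definition positive_op : set (E -> F) :=
  [set T | linear T /\ forall x : E, 0 <=v x -> 0 <=v T x].

(* Boundedness is not part of the definition, as in the usual one; on a Banach
   lattice positive operators are automatically bounded. *)
Definition is_regular : set (E -> F) :=
  [set T | exists T1 T2 : E -> F,
     [/\ positive_op T1, positive_op T2 & T = T1 - T2]].

Definition regular_pred : {pred E -> F} := mem is_regular.

Record regular_op := RegularOp {
  regular_fun :> E -> F;
  _ : regular_fun \in regular_pred
}.

HB.instance Definition _ := [isSub for regular_fun].
HB.instance Definition _ := [Choice of regular_op by <:].

Lemma positive_op0 : positive_op 0.
Proof.
split=> [a x y|x _]; last exact: vle_refl.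
by rewrite -[RHS]/(a *: 0 + 0) scaler0 addr0.
Qed.

Lemma vle_addr_ge0 (x y : F) : 0 <=v x -> 0 <=v y -> 0 <=v x + y.
Proof.
by move=> x0 /(vleD2r x); rewrite add0r addrC; exact: vle_trans.
Qed.

Lemma positive_opD T1 T2 :
  positive_op T1 -> positive_op T2 -> positive_op (T1 + T2).
Proof.
move=> [l1 p1] [l2 p2]; split=> [a x y|x x0]; rewrite !fctE.
  by rewrite l1 l2 scalerDr addrACA.
by apply: vle_addr_ge0; [exact: p1|exact: p2].
Qed.

Lemma positive_opZ (a : R) T : 0 <= a -> positive_op T -> positive_op (a *: T).
Proof.
move=> a0 [l p]; split=> [b x y|x x0]; rewrite !fctE.
  by rewrite l scalerDr !scalerA mulrC.
by apply: scalev_ge0 => //; exact: p.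
Qed.

Lemma regular_submod_closed : submod_closed regular_pred.
Proof.
split; first by apply/mem_set; exists 0, 0; rewrite subr0;
  split=> //; exact: positive_op0.
move=> a S T /set_mem[S1 [S2 [S1p S2p ->]]] /set_mem[T1 [T2 [T1p T2p ->]]].
apply/mem_set; have [a0|/ltW a0] := leP 0 a.
  exists (a *: S1 + T1), (a *: S2 + T2); split.
  - by apply: positive_opD => //; exact: positive_opZ.
  - by apply: positive_opD => //; exact: positive_opZ.
  - by rewrite scalerBr opprD addrACA.
exists ((- a) *: S2 + T1), ((- a) *: S1 + T2); split.
- by apply: positive_opD => //; apply: positive_opZ => //; rewrite oppr_ge0.
- by apply: positive_opD => //; apply: positive_opZ => //; rewrite oppr_ge0.
- by rewrite !scaleNr scalerBr opprD opprK [RHS]addrACA [- _ + _]addrC.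
Qed.

HB.instance Definition _ :=
  GRing.isSubmodClosed.Build R (E -> F) regular_pred regular_submod_closed.
HB.instance Definition _ :=
  [SubChoice_isSubLmodule of regular_op by <:].

Definition regular_le (S T : regular_op) : Prop :=
  positive_op ((T : E -> F) - (S : E -> F)).

Lemma regular_le_refl S : regular_le S S.
Proof. by rewrite /regular_le subrr; exact: positive_op0. Qed.

Lemma regular_le_anti S T : regular_le S T -> regular_le T S -> S = T.
Proof.
move=> [TSl TSp] [STl STp].
have posE (x : E) : 0 <=v x -> S x = T x.
  move=> x0; have := vleD2r (S x) _ _ (TSp _ x0).
  have := vleD2r (T x) _ _ (STp _ x0).
  by rewrite !fctE !add0r !subrK => TS ST; exact: vle_anti.
pose D : E -> F := (T : E -> F) - (S : E -> F).
have D0 (x : E) : 0 <=v x -> D x = 0.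
  by move=> x0; rewrite /D !fctE posE// subrr.
have DB (x y : E) : D (x - y) = D x - D y.
  by have := TSl (- 1) y x; rewrite !scaleN1r ![- _ + _]addrC.
apply/val_inj/funext => x /=; apply/esym/eqP; rewrite -subr_eq0; apply/eqP.
rewrite -[LHS]/(D x).
have [u [u_ub _]] := blat_vector_lattice x 0.
have xu : x <=v u by apply: u_ub; left.
have u0 : 0 <=v u by apply: u_ub; right.
have ux0 : 0 <=v u - x by have := vleD2r (- x) _ _ xu; rewrite subrr.
have -> : x = u - (u - x) by rewrite opprB addrC subrK.
by rewrite DB !D0 ?subr0.
Qed.

Lemma regular_le_trans T S U :
  regular_le S T -> regular_le T U -> regular_le S U.
Proof.
by move=> ST TU; have := positive_opD TU ST; rewrite addrA subrK.
Qed.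

Lemma regular_leD2r U S T : regular_le S T -> regular_le (S + U) (T + U).
Proof. by rewrite /regular_le /= opprD addrACA subrr addr0. Qed.

Lemma regular_scale_ge0 (a : R) T :
  0 <= a -> regular_le 0 T -> regular_le 0 (a *: T).
Proof. by move=> a0; rewrite /regular_le /= !subr0; exact: positive_opZ. Qed.

HB.instance Definition _ :=
  isOrderedLmodule.Build R regular_op regular_le_refl regular_le_anti
    regular_le_trans regular_leD2r regular_scale_ge0.

(* S is only required to range over the bounded operators, so that the property
   is no stronger than the one quantifying over all positive S <= T. *)
Definition domination_property (P : set (E -> F)) : Prop :=
  forall S T : E -> F, bounded_op S ->
    positive_op S -> positive_op (T - S) -> P T -> P S.

Definition r_class (P : set (E -> F)) : set regular_op :=
  [set T | exists T1 T2 : E -> F,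
     [/\ P T1 /\ positive_op T1, P T2 /\ positive_op T2
       & (T : E -> F) = T1 - T2]].

End Operators.

(* Main.v *)
Require Import Defs.
From mathcomp Require Import all_boot all_order all_algebra.
From mathcomp Require Import all_classical all_reals all_analysis.

(** The statement has two halves: the theorem of Riesz and Kantorovich that
    regular operators into a Dedekind complete lattice form a Dedekind complete
    vector lattice, and the ideal property.

    Riesz-Kantorovich.  The usual formulas give the supremum of two operators
    first and treat directed families separately.  Here one formula serves every
    nonempty set A of linear operators that is bounded above: its
    supremum sends x >= 0 to
      sup {T1 x1 + ... + Tn xn | Ti in A, xi >= 0, x1 + ... + xn = x},
    which exists because F is Dedekind complete and an upper bound U of A bounds
    each such sum by U x.  Concatenating partitions makes this value
    superadditive in x; the Riesz decomposition property of E, which splits a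
    partition of x + y into a partition of x and one of y
    ([partition_sum_split]), makes it subadditive.  An additive, positively
    homogeneous map on the positive cone extends to a linear map
    ([linear_cone_extension]), and this gives [operator_supremum].  Binary
    suprema are then a special case, since any two regular operators have a
    common upper bound.

    Ideal property.  Let |S| <= |T| with T = T1 - T2 and Ti >= 0 in P.  Then
    0 <= |S| <= |T| <= T1 + T2, so |S| is in P by domination.  In
    S = |S| - (|S| - S) the second term satisfies 0 <= |S| - S <= 2|S|, so it is
    in P too, and S is a difference of two positive members of P.  The
    domination property is only available for bounded operators, which costs
    nothing: on the ball of radius r, a positive operator below T obeys every
    norm bound that T obeys ([dominated_bounded]). *)

Set Implicit Arguments.
Unset Strict Implicit.
Unset Printing Implicit Defensive.

Import Order.TTheory GRing.Theory Num.Theory.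
Import numFieldNormedType.Exports.

Local Open Scope classical_set_scope.
Local Open Scope ring_scope.

(** * Ordered vector spaces *)

Section OrderedVectorSpaceTheory.
Context {R : realType}.

Section Order.
Context {V : orderedLmodType R}.
Implicit Types x y z t : V.

Lemma subv_ge0 x y : 0 <=v y - x <-> x <=v y.
Proof.
split=> [/(vleD2r x)|/(vleD2r (- x))]; first by rewrite add0r subrK.
by rewrite subrr.
Qed.

Lemma vleD2l z x y : x <=v y -> z + x <=v z + y.
Proof. by rewrite ![z + _]addrC; exact: vleD2r. Qed.

Lemma vleD x y z t : x <=v y -> z <=v t -> x + z <=v y + t.
Proof. by move=> /(vleD2r z) xy /(vleD2l y); exact: vle_trans. Qed.

Lemma vle_addr x y : 0 <=v y -> x <=v x + y.
Proof. by move=> /(vleD2l x); rewrite addr0. Qed.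

Lemma vleBlD x y z : x - y <=v z <-> x <=v z + y.
Proof. by rewrite -!(subv_ge0 _ z) -(subv_ge0 x) opprB addrA. Qed.

Lemma vleBrD x y z : x <=v y - z <-> x + z <=v y.
Proof. by rewrite -(subv_ge0 x) -(subv_ge0 (x + z)) opprD addrAC addrA. Qed.

Lemma addv_ge0 x y : 0 <=v x -> 0 <=v y -> 0 <=v x + y.
Proof. by move=> x0 y0; rewrite -(addr0 0); exact: vleD. Qed.

Lemma vleN2 x y : x <=v y -> - y <=v - x.
Proof. by move=> /subv_ge0 xy; apply/subv_ge0; rewrite opprK addrC. Qed.

Lemma ler_vscale (a : R) x y : 0 <= a -> x <=v y -> a *: x <=v a *: y.
Proof.
by move=> a0 /subv_ge0 xy; apply/subv_ge0; rewrite -scalerBr; exact: scalev_ge0.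
Qed.

Lemma vleB_addr x y : 0 <=v y -> x - y <=v x + y.
Proof.
by move=> y0; apply/vleBlD; rewrite -addrA; exact/vle_addr/addv_ge0.
Qed.

Lemma vle_scaleVr (a : R) x y : 0 < a -> x <=v a^-1 *: y <-> a *: x <=v y.
Proof.
move=> a0; split=> [/(ler_vscale (ltW a0))|].
  by rewrite scalerA divff ?gt_eqF// scale1r.
have /ltW ai0 : 0 < a^-1 by rewrite invr_gt0.
by move=> /(ler_vscale ai0); rewrite scalerA mulVf ?gt_eqF// scale1r.
Qed.

End Order.

Section Lattice.
Context {V : orderedLmodType R}.
Implicit Types (x y : V) (A B : set V).

Lemma suprema_unique A x y : suprema A x -> suprema A y -> x = y.
Proof. by move=> [xA xm] [yA ym]; apply: vle_anti; [exact: xm|exact: ym]. Qed.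

(** If u bounds all the sums, then for a fixed b in B the vector u - b bounds A,
    so x <= u - b; hence u - x bounds B, and x + y <= u. *)
Lemma supremaD A B C x y :
  (forall a b, A a -> B b -> C (a + b)) ->
  (forall c, C c -> exists a b, [/\ A a, B b & c = a + b]) ->
  suprema A x -> suprema B y -> suprema C (x + y).
Proof.
move=> ABC CAB [xA xm] [yB ym]; split=> [c /CAB[a [b [Aa Bb ->]]]|u uC].
  by apply: vleD; [exact: xA|exact: yB].
rewrite addrC; apply/vleBrD; apply: ym => b Bb; apply/vleBrD; rewrite addrC.
by apply/vleBrD; apply: xm => a Aa; apply/vleBrD/uC/ABC.
Qed.

Lemma supremaZ A B (a : R) x : 0 < a ->
  (forall y, A y -> B (a *: y)) -> (forall y, B y -> A (a^-1 *: y)) ->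
  suprema A x -> suprema B (a *: x).
Proof.
move=> a0 AB BA [xA xm]; have ai0 : 0 < a^-1 by rewrite invr_gt0.
split=> [y /BA/xA|u uB].
  by rewrite -{2}[a]invrK; move/(vle_scaleVr _ _ ai0).
by apply/(vle_scaleVr _ _ a0)/xm => y /AB/uB /(vle_scaleVr _ _ a0).
Qed.

Hypothesis V_lat : is_vector_lattice V.

Lemma modulus_sup x : suprema [set x; - x] (modulus x).
Proof. by apply: xgetPex; exact: V_lat. Qed.

Lemma le_modulus x : x <=v modulus x.
Proof. by have [h _] := modulus_sup x; apply: h; left. Qed.

Lemma leN_modulus x : - x <=v modulus x.
Proof. by have [h _] := modulus_sup x; apply: h; right. Qed.

Lemma modulus_le x y : x <=v y -> - x <=v y -> modulus x <=v y.
Proof. by have [_ h] := modulus_sup x => xy nxy; apply: h => z [] ->. Qed.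

Lemma modulus_ge0 x : 0 <=v modulus x.
Proof.
have -> : modulus x = 2^-1 *: (modulus x + modulus x).
  by rewrite -mulr2n -(scaler_nat 2 (modulus x)) scalerA mulVf ?scale1r ?pnatr_eq0.
apply: scalev_ge0; first by rewrite invr_ge0.
by rewrite -(subrr x); apply: vleD; [exact: le_modulus|exact: leN_modulus].
Qed.

Lemma modulus_id x : modulus (modulus x) = modulus x.
Proof.
apply: vle_anti; last exact: le_modulus.
apply: modulus_le; first exact: vle_refl.
apply: vle_trans (modulus_ge0 x).
by rewrite -oppr0; apply: vleN2; exact: modulus_ge0.
Qed.

Lemma ge0_difference x : exists u v, [/\ 0 <=v u, 0 <=v v & x = u - v].
Proof.
exists (modulus x), (modulus x - x); split; first exact: modulus_ge0.
  by apply/subv_ge0; exact: le_modulus.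
by rewrite opprB addrC subrK.
Qed.

(** Negation reverses the order, so the infimum is minus the supremum of the
    negatives. *)
Lemma infimum_exists x y :
  exists m, [/\ m <=v x, m <=v y & forall v, v <=v x -> v <=v y -> v <=v m].
Proof.
have [w [w_ub w_min]] := V_lat (- x) (- y); exists (- w); split=> [||v vx vy].
- by rewrite -[x]opprK; apply: vleN2; apply: w_ub; left.
- by rewrite -[y]opprK; apply: vleN2; apply: w_ub; right.
- by rewrite -[v]opprK; apply: vleN2; apply: w_min => u [] ->; exact: vleN2.
Qed.

(** The Riesz decomposition property: two ways of writing a positive vector as
    a sum of two positive ones have a common refinement, obtained by letting the
    first block x1 be as large as possible, namely inf(z1, x). *)
Lemma riesz_decomposition z1 z2 x y :
  0 <=v z1 -> 0 <=v z2 -> 0 <=v x -> 0 <=v y -> z1 + z2 = x + y ->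
  exists x1 x2 y1 y2 : V,
    [/\ [/\ 0 <=v x1, 0 <=v x2, 0 <=v y1 & 0 <=v y2], x = x1 + x2,
       y = y1 + y2, z1 = x1 + y1 & z2 = x2 + y2].
Proof.
move=> z1_0 z2_0 x0 y0 zxy.
have [m [mz mx m_max]] := infimum_exists z1 x.
exists m, (x - m), (z1 - m), (y - (z1 - m)).
split; [split| | | |].
- exact: m_max.
- exact/subv_ge0.
- exact/subv_ge0.
(* y2 >= 0 amounts to z1 - y <= m, which holds because z1 - y is itself a lower
   bound of z1 and x. *)
- apply/subv_ge0/vleBlD; rewrite addrC; apply/vleBlD; apply: m_max.
    by apply/vleBlD; exact: vle_addr.
  by apply/vleBlD; rewrite -zxy; exact: vle_addr.
- by rewrite addrC subrK.
- by rewrite [RHS]addrC subrK.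
- by rewrite addrC subrK.
- by rewrite opprB addrACA addKr -zxy addrC addKr.
Qed.

End Lattice.

(** * Suprema of sets of operators *)

Section LinearMaps.
Context {V W : lmodType R} {T : V -> W}.
Hypothesis T_lin : linear T.

Lemma linear_add x y : T (x + y) = T x + T y.
Proof. by have := T_lin 1 x y; rewrite !scale1r. Qed.

Lemma linear_sub x y : T (x - y) = T x - T y.
Proof. by have := T_lin (- 1) y x; rewrite !scaleN1r ![- _ + _]addrC. Qed.

Lemma linear_zero : T 0 = 0.
Proof. by rewrite -(subrr 0) linear_sub subrr. Qed.

Lemma linear_opp x : T (- x) = - T x.
Proof. by rewrite -sub0r linear_sub linear_zero sub0r. Qed.

Lemma linear_scale a x : T (a *: x) = a *: T x.
Proof. by have := T_lin a x 0; rewrite linear_zero !addr0. Qed.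

End LinearMaps.

Section OperatorSuprema.
Context {E F : orderedLmodType R}.
Hypothesis E_lat : is_vector_lattice E.
Hypothesis F_dc : dedekind_complete F.

(** Every vector is a difference of positive ones, and additivity makes
    G u - G v depend only on u - v.  The canonical choice u = |x|, v = |x| - x
    turns this into a definition of the extension without choosing. *)
Lemma linear_cone_extension (G : E -> F) :
  (forall x y, 0 <=v x -> 0 <=v y -> G (x + y) = G x + G y) ->
  (forall (a : R) x, 0 < a -> 0 <=v x -> G (a *: x) = a *: G x) ->
  exists L : E -> F, linear L /\ forall x, 0 <=v x -> L x = G x.
Proof.
move=> GD GZ; pose L x := G (modulus x) - G (modulus x - x).
have LE x u v : 0 <=v u -> 0 <=v v -> x = u - v -> L x = G u - G v.
  move=> u0 v0 xuv.
  have m0 : 0 <=v modulus x by exact: modulus_ge0.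
  have mx0 : 0 <=v modulus x - x by apply/subv_ge0; exact: le_modulus.
  have GE : G (modulus x) + G v = G u + G (modulus x - x).
    have vE : v = u - x by rewrite xuv opprB addrC subrK.
    by rewrite -!GD// vE addrCA.
  by apply/eqP; rewrite subr_eq addrAC -GE addrK.
exists L; split=> [a x y|x x0]; last first.
  (* x = x - 0 gives G x - G 0, and G 0 = 0 by additivity. *)
  rewrite (LE x x 0) ?subr0//; last exact: vle_refl.
  rewrite -[RHS]subr0; congr (_ - _).
  by apply: (addIr (G 0)); rewrite add0r -GD ?addr0//; exact: vle_refl.
have LD x' y' : L (x' + y') = L x' + L y'.
  have [u [v [u0 v0 ->]]] := ge0_difference E_lat x'.
  have [s [t [s0 t0 ->]]] := ge0_difference E_lat y'.
  rewrite (LE (u - v) u v)// (LE (s - t) s t)//.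
  rewrite (LE _ (u + s) (v + t)) ?GD//.
  - by rewrite opprD addrACA.
  - exact: addv_ge0.
  - exact: addv_ge0.
  - by rewrite opprD addrACA.
rewrite LD; congr (_ + _).
have [u [v [u0 v0 ->]]] := ge0_difference E_lat x.
rewrite (LE (u - v) u v)// scalerBr.
have [a0|a0|->] := ltgtP a 0.
(* A negative scalar exchanges the two parts of the difference. *)
- have na0 : 0 < - a by rewrite oppr_gt0.
  have na_ge0 (w : E) : 0 <=v w -> 0 <=v (- a) *: w by apply/scalev_ge0/ltW.
  rewrite (LE _ ((- a) *: v) ((- a) *: u)) ?GZ//; [|exact: na_ge0..|].
    by rewrite !scaleNr opprK scalerBr addrC.
  by rewrite !scaleNr opprK addrC.
- by rewrite (LE _ (a *: u) (a *: v)) ?GZ ?scalerBr//; apply: scalev_ge0 => //; exact: ltW.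
- by rewrite !scale0r subrr (LE 0 u u) ?subrr.
Qed.

Section RieszKantorovich.
Variable A : set (E -> F).
Hypothesis A_lin : forall T, A T -> linear T.

(** The relation between x and the sums T1 x1 + ... + Tn xn over all finite
    partitions x = x1 + ... + xn into positive parts, with Ti in A.  Building
    them by concatenation, rather than from sequences, reduces every fact about
    partitions to an induction whose step concerns two parts only. *)
Inductive partition_sum : E -> F -> Prop :=
| partition_single T x : A T -> 0 <=v x -> partition_sum x (T x)
| partition_cat x y f g : partition_sum x f -> partition_sum y g ->
    partition_sum (x + y) (f + g).

Lemma partition_sum_ge0 x f : partition_sum x f -> 0 <=v x.
Proof. by elim=> // *; exact: addv_ge0. Qed.

(** This is where the lattice structure of E enters: the Riesz decomposition
    refines a partition of x + y so that each part belongs to x or to y. *)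
Lemma partition_sum_split z f : partition_sum z f ->
  forall x y, 0 <=v x -> 0 <=v y -> z = x + y ->
  exists g h, [/\ partition_sum x g, partition_sum y h & f = g + h].
Proof.
elim=> [T w AT w0|z1 z2 f1 f2 p1 IH1 p2 IH2] x y x0 y0 zxy.
  exists (T x), (T y); split; [exact: partition_single..|].
  by rewrite zxy (linear_add (A_lin AT)).
have [x1 [x2 [y1 [y2 [[x10 x20 y10 y20] -> -> z1E z2E]]]]] :=
  riesz_decomposition E_lat (partition_sum_ge0 p1) (partition_sum_ge0 p2)
    x0 y0 zxy.
have [g1 [h1 [px1 py1 ->]]] := IH1 _ _ x10 y10 z1E.
have [g2 [h2 [px2 py2 ->]]] := IH2 _ _ x20 y20 z2E.
exists (g1 + g2), (h1 + h2); split; [exact: partition_cat..|].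
by rewrite addrACA.
Qed.

Lemma partition_sumZ a x f :
  0 <= a -> partition_sum x f -> partition_sum (a *: x) (a *: f).
Proof.
move=> a0; elim=> [T w AT w0|z1 z2 f1 f2 _ IH1 _ IH2].
  rewrite -(linear_scale (A_lin AT)).
  by apply: partition_single => //; exact: scalev_ge0.
by rewrite !scalerDr; exact: partition_cat.
Qed.

Lemma partition_sum_le (U : E -> F) : linear U ->
  (forall T x, A T -> 0 <=v x -> T x <=v U x) ->
  forall x f, partition_sum x f -> f <=v U x.
Proof.
move=> Ul AU x f; elim=> [T w AT w0|z1 z2 f1 f2 _ IH1 _ IH2]; first exact: AU.
by rewrite (linear_add Ul); exact: vleD.
Qed.

(** The supremum of A for the order defined by the positive cone.  The
    upper bound U and the member T0 make each set of partition sums bounded and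
    nonempty, as Dedekind completeness of F requires. *)
Theorem operator_supremum (T0 U : E -> F) : A T0 -> linear U ->
  (forall T x, A T -> 0 <=v x -> T x <=v U x) ->
  exists L : E -> F,
    [/\ linear L, forall T x, A T -> 0 <=v x -> T x <=v L x
      & forall W : E -> F, linear W ->
        (forall T x, A T -> 0 <=v x -> T x <=v W x) ->
        forall x, 0 <=v x -> L x <=v W x].
Proof.
move=> AT0 Ul AU; pose G x := xget 0 (suprema (partition_sum x)).
have Gsup x : 0 <=v x -> suprema (partition_sum x) (G x).
  move=> x0; apply: xgetPex; apply: F_dc.
    by exists (T0 x); exact: partition_single.
  by exists (U x) => f; exact: partition_sum_le.
have [L [Ll LG]] : exists L : E -> F, linear L /\ forall x, 0 <=v x -> L x = G x.
  apply: linear_cone_extension => [x y x0 y0|a x a0 x0].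
    apply: suprema_unique (Gsup _ (addv_ge0 x0 y0)) _.
    apply: supremaD (Gsup _ x0) (Gsup _ y0) => [f g|f pf].
      exact: partition_cat.
    exact: (partition_sum_split pf).
  have ax0 : 0 <=v a *: x by apply: scalev_ge0 => //; exact: ltW.
  apply: suprema_unique (Gsup _ ax0) _.
  apply: (supremaZ a0 _ _ (Gsup _ x0)) => f; first exact/partition_sumZ/ltW.
  have aV : a^-1 * a = 1 by rewrite mulVf ?gt_eqF.
  rewrite -{2}[x]scale1r -aV -scalerA.
  by apply: partition_sumZ; rewrite invr_ge0 ltW.
exists L; split=> // [T x AT x0|W Wl AW x x0]; rewrite LG//.
  by have [Gub _] := Gsup _ x0; apply: Gub; exact: partition_single.
have [_ Gmin] := Gsup _ x0; apply: Gmin => f; exact: partition_sum_le.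
Qed.

End RieszKantorovich.
End OperatorSuprema.
End OrderedVectorSpaceTheory.

(** * Regular operators *)

Section RegularOperators.
Context {R : realType} {E F : banachLatticeType R}.
Implicit Types S T U : regular_op E F.

Lemma positive_is_regular (S : E -> F) : positive_op S -> is_regular S.
Proof. by exists S, 0; split; [|exact: positive_op0|rewrite subr0]. Qed.

Lemma regular_linear T : linear T.
Proof.
have /set_mem[T1 [T2 [[l1 _] [l2 _] TE]]] := valP T.
move=> a x y; rewrite -[LHS]/(val T _) -[RHS]/(a *: val T _ + val T _) TE !fctE.
by rewrite l1 l2 scalerBr opprD addrACA.
Qed.

Lemma regular_leP S T : S <=v T <-> forall x : E, 0 <=v x -> S x <=v T x.
Proof.
split=> [[_ ST] x x0|ST]; first by apply/subv_ge0; exact: ST.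
split=> [a x y|x x0]; last by apply/subv_ge0; exact: ST.
by rewrite !fctE !regular_linear scalerBr opprD addrACA.
Qed.

(** The supremum L of linear maps is regular because L - T0 is positive for any
    T0 in A, while T0 is a difference of positive operators. *)
Lemma regular_dedekind_complete :
  dedekind_complete F -> dedekind_complete (regular_op E F).
Proof.
move=> F_dc A [T0 AT0] [U UA].
pose B := [set (T : E -> F) | T in A].
have B_lin (T : E -> F) : B T -> linear T.
  by move=> [T' _ <-]; exact: regular_linear.
have BU (T : E -> F) x : B T -> 0 <=v x -> T x <=v U x.
  by move=> [T' AT' <-] x0; apply: (regular_leP _ _).1 x0; exact: UA.
have [L [Ll BL Lmin]] := operator_supremum (@blat_vector_lattice _ E) F_dc B_lin
  (imageP _ AT0) (regular_linear U) BU.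
have L_reg : is_regular L.
  have /set_mem[T1 [T2 [T1p T2p T0E]]] := valP T0.
  have -> : L = (L - (T0 : E -> F) + T1) - T2.
    by rewrite -addrA -T0E subrK.
  exists (L - (T0 : E -> F) + T1), T2; split=> //; apply: positive_opD => //.
  split=> [a x y|x x0]; rewrite !fctE.
    by rewrite Ll regular_linear scalerBr opprD addrACA.
  by apply/subv_ge0/BL => //; exists T0.
exists (RegularOp (mem_set L_reg)); split=> [T AT|W WA]; apply/regular_leP.
  by move=> x x0; apply: BL => //; exists T.
move=> x x0; apply: Lmin => //; first exact: regular_linear.
by move=> T y [T' AT' <-] y0; apply: (regular_leP _ _).1 y0; exact: WA.
Qed.

(** A pair has an upper bound, obtained by adding the positive parts of two
    decompositions; its supremum then exists by Dedekind completeness. *)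
Lemma regular_vector_lattice :
  dedekind_complete F -> is_vector_lattice (regular_op E F).
Proof.
move=> F_dc S T; apply: (regular_dedekind_complete F_dc); first by exists S; left.
have regular_ub U : exists V : regular_op E F, 0 <=v V /\ U <=v V.
  have /set_mem[U1 [U2 [U1p U2p UE]]] := valP U.
  exists (RegularOp (mem_set (positive_is_regular U1p))); split; apply/regular_leP => x x0.
    exact: U1p.2.
  rewrite -[U x]/(val U x) UE.
  by apply/vleBlD; apply: vle_addr; exact: U2p.2.
have [V [V0 SV]] := regular_ub S; have [W [W0 TW]] := regular_ub T.
exists (V + W) => U [->|->]; [rewrite -[S]addr0|rewrite -[T]add0r]; exact: vleD.
Qed.

(** Since |S x| <= S |x| <= T |x| and the vectors x and |x| have the same norm,
    a bound of T on the ball of radius r is also one of S. *)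
Lemma dominated_bounded (S T : E -> F) :
  positive_op S -> positive_op (T - S) -> linear T -> bounded_fun_norm T ->
  bounded_fun_norm S.
Proof.
move=> [Sl S0] [_ TS0] Tl Tb r; have [M TM] := Tb r; exists M => x xr.
have lE := @blat_vector_lattice _ E; have lF := @blat_vector_lattice _ F.
have ST y : 0 <=v y -> S y <=v T y by move=> y0; apply/subv_ge0/TS0.
have Smono y z : y <=v z -> S y <=v S z.
  by move=> /subv_ge0/S0; rewrite (linear_sub Sl) => /subv_ge0.
have m0 := modulus_ge0 lE x.
apply: (@le_trans _ _ `|T (modulus x)|).
  apply: blat_norm_le; apply: vle_trans (le_modulus lF _).
  apply: vle_trans (ST _ m0).
  apply: modulus_le => //; first by apply/Smono/le_modulus.
  by rewrite -(linear_opp Sl); apply/Smono/leN_modulus.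
apply: TM; apply: le_trans xr; apply: blat_norm_le.
by rewrite modulus_id//; exact: vle_refl.
Qed.

Section RClass.
Variable P : set (E -> F).
Hypothesis P_bounded : P `<=` bounded_op (E := E) (F := F).
Hypothesis P_subspace : linear_subspace P.
Hypothesis P_dom : domination_property P.

Lemma subspace0 : P 0. Proof. by case: P_subspace. Qed.

Lemma subspaceD (S T : E -> F) : P S -> P T -> P (S + T).
Proof. by move=> PS PT; have := P_subspace.2 1 S T PS PT; rewrite scale1r. Qed.

Lemma subspaceZ (a : R) (T : E -> F) : P T -> P (a *: T).
Proof.
by move=> PT; have := P_subspace.2 a T 0 PT subspace0; rewrite addr0.
Qed.

Lemma dominated_in_class (S T : E -> F) :
  positive_op S -> positive_op (T - S) -> P T -> P S.
Proof.
move=> Sp TSp PT; have [Tl Tb] := P_bounded PT.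
by apply: (P_dom _ Sp TSp PT); split; [case: Sp|exact: dominated_bounded TSp Tl Tb].
Qed.

(** For a negative scalar a, the decomposition of a S uses - a and exchanges the
    two positive parts, which keeps both of them positive. *)
Lemma r_class_subspace : linear_subspace (r_class P).
Proof.
have P0 : P 0 /\ positive_op (0 : E -> F).
  by split; [exact: subspace0|exact: positive_op0].
have PD (S T : E -> F) :
    P S /\ positive_op S -> P T /\ positive_op T -> P (S + T) /\ positive_op (S + T).
  by move=> [PS Sp] [PT Tp]; split; [exact: subspaceD|exact: positive_opD].
have PZ (a : R) (T : E -> F) :
    0 <= a -> P T /\ positive_op T -> P (a *: T) /\ positive_op (a *: T).
  by move=> a0 [PT Tp]; split; [exact: subspaceZ|exact: positive_opZ].
split; first by exists 0, 0; rewrite subr0.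
move=> a S T [S1 [S2 [S1p S2p SE]]] [T1 [T2 [T1p T2p TE]]].
have aSTE : (a *: S + T : E -> F) = a *: (S1 - S2) + (T1 - T2).
  by rewrite -SE -TE.
have [a0|/ltW a0] := leP 0 a.
  exists (a *: S1 + T1), (a *: S2 + T2); split; [by apply/PD/T1p/PZ|by apply/PD/T2p/PZ|].
  by rewrite aSTE scalerBr opprD addrACA.
have na0 : 0 <= - a by rewrite oppr_ge0.
exists ((- a) *: S2 + T1), ((- a) *: S1 + T2); split; [by apply/PD/T1p/PZ|by apply/PD/T2p/PZ|].
by rewrite aSTE !scaleNr scalerBr opprD opprK [RHS]addrACA [- _ + _]addrC.
Qed.

Lemma r_class_ideal : dedekind_complete F -> order_ideal (r_class P).
Proof.
move=> F_dc; split; first exact: r_class_subspace.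
move=> S T ST [T1 [T2 [[PT1 T1p] [PT2 T2p] TE]]].
have lat := regular_vector_lattice F_dc.
pose T12 := RegularOp (mem_set (positive_is_regular (positive_opD T1p T2p))).
have mT : modulus T <=v T12.
  have Tx x : T x = T1 x - T2 x by rewrite TE.
  apply: modulus_le => //; apply/regular_leP => x x0.
    by rewrite Tx; apply/vleB_addr/T2p.2.
  rewrite -[(- T) x]/(- T x) -[T12 x]/(T1 x + T2 x) Tx opprB [T1 x + _]addrC.
  by apply/vleB_addr/T1p.2.
have mS : modulus S <=v T12 by exact: vle_trans mT.
have mSp : positive_op (modulus S).
  by have := modulus_ge0 lat S; rewrite /vle/= /regular_le/= subr0.
have PmS : P (modulus S).
  by apply: dominated_in_class (subspaceD PT1 PT2) => //; exact: mS.
(* |S| - S <= |S| + |S| because - S <= |S|. *)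
exists (modulus S), ((modulus S : E -> F) - S); split=> //; first split.
- apply: dominated_in_class (subspaceD PmS PmS).
    exact: (le_modulus lat S).
  exact: (vleD2l (modulus S) (leN_modulus lat S)).
- exact: (le_modulus lat S).
- by rewrite opprB addrC subrK.
Qed.

End RClass.
End RegularOperators.

Theorem proposition1p6p3 (R : realType) (E F : banachLatticeType R)
    (F_dc : dedekind_complete F) (P : set (E -> F))
    (P_bounded : P `<=` bounded_op (E := E) (F := F))
    (P_subspace : linear_subspace P)
    (P_dom : domination_property P) :
  [/\ is_vector_lattice (regular_op E F),
      dedekind_complete (regular_op E F)
    & order_ideal (r_class P)].
Proof.
split; first exact: regular_vector_lattice.
- exact: regular_dedekind_complete.
- exact: r_class_ideal.
Qed.
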